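(* Let $x,y$ be non-commuting indeterminates and $C=xyx^{-1}y^{-1}$. Let $(R_n)_{n\in\mathbb Z}$ satisfy $$R_{2n}CR_{2n-2}=1+R_{2n-1},\qquad R_{2n+1}CR_{2n-1}=1+R_{2n}^4\qquad(n\in\mathbb Z),$$ with $R_0=yxy^{-1}$ and $R_1=y$, and set $u_n=R_{2n}$, so that $u_0=yxy^{-1}$. Define $$y_1=(1+y)x^{-1}yx^{-1}y^{-1},$$ $$y_2=\big(x^2+(1+y)x^{-2}(1+y)\big)y^{-1}x^{-1}yx^{-1}y^{-1},$$ $$y_3=\big(x^3+(1+y)x^{-1}\big)x^{-1}y^{-1}.$$ Then, as formal power series in a central variable $t$, $$\sum_{n\ge0}t^nu_n=\Big(1-ty_1-t^2(1-ty_3)^{-1}y_2\Big)^{-1}u_0.$$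
   Context: Work in the free skew field (non-commutative rational functions) over $\mathbb C$ generated by $x,y$. The variable $t$ is a formal variable commuting with everything, and inverses of $1-(\text{terms of positive }t\text{-degree})$ are expanded as geometric series. *)

(* Defs.v *)
From HB Require Import structures.
From mathcomp Require Import all_boot all_order all_algebra.
From mathcomp Require Import complex.
From mathcomp Require Import Rstruct.
Set Implicit Arguments. Unset Strict Implicit. Unset Printing Implicit Defensive.
Import Order.TTheory GRing.Theory Num.Theory.
Local Open Scope ring_scope.

Definition CC : Type := complex Rdefinitions.R.

Section FreeField.
Variable D : unitAlgType CC.

Definition word (x y : D) (w : seq bool) : D :=
  \prod_(b <- w) (if b then y else x).

Definition free_monomials (x y : D) : Prop :=
  forall (s : seq (seq bool)) (c : seq CC),
    uniq s -> size c = size s ->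
    \sum_(i < size s) c`_i *: word x y (nth [::] s i) = 0 ->
    forall i, c`_i = 0.

Definition in_ncpoly (x y : D) (a : D) : Prop :=
  exists (s : seq (seq bool)) (c : seq CC),
    a = \sum_(i < size s) c`_i *: word x y (nth [::] s i).

Definition mx_over (x y : D) m n (M : 'M[D]_(m, n)) : Prop :=
  forall i j, in_ncpoly x y (M i j).

Definition full_over (x y : D) n (M : 'M[D]_n) : Prop :=
  ~ exists r, exists (P : 'M[D]_(n, r)) (Q : 'M[D]_(r, n)),
      (r < n)%N /\ mx_over x y P /\ mx_over x y Q /\ M = P *m Q.

Definition mx_invertible n (M : 'M[D]_n) : Prop :=
  exists N : 'M[D]_n, M *m N = 1%:M /\ N *m M = 1%:M.

Inductive in_divgen (x y : D) : D -> Prop :=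
| dg_x : in_divgen x y x
| dg_y : in_divgen x y y
| dg_scal (c : CC) : in_divgen x y (c%:A)
| dg_add a b : in_divgen x y a -> in_divgen x y b -> in_divgen x y (a + b)
| dg_opp a : in_divgen x y a -> in_divgen x y (- a)
| dg_mul a b : in_divgen x y a -> in_divgen x y b -> in_divgen x y (a * b)
| dg_inv a : in_divgen x y a -> in_divgen x y (a^-1).

(* (D, x, y) is the free skew field over C on x, y: D is a division
   C-algebra, generated (as a division ring over C) by x and y, which
   generate a free subalgebra C<x,y>, and every full matrix over C<x,y>
   becomes invertible in D (Cohn's characterisation of the universal
   field of fractions of the free algebra). *)
Definition is_free_skew_field (x y : D) : Prop :=
  [/\ (forall a : D, a != 0 -> a \is a GRing.unit),
      free_monomials x y,
      (forall n (M : 'M[D]_n), mx_over x y M -> full_over x y M ->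
          mx_invertible M)
    & (forall a : D, in_divgen x y a)].

Definition pser := nat -> D.
Definition psC (a : D) : pser := fun n => if n == 0%N then a else 0.
Definition pst : pser := fun n => if n == 1%N then 1 else 0.
Definition psadd (f g : pser) : pser := fun n => f n + g n.
Definition psmul (f g : pser) : pser :=
  fun n => \sum_(i < n.+1) f i * g (n - i)%N.
Definition psone : pser := psC 1.
Definition pspow (f : pser) (k : nat) : pser := iter k (psmul f) psone.
(* (1 - f)^{-1} expanded as the geometric series sum_k f^k; this is the
   intended meaning when f has zero constant term (positive t-degree),
   in which case only k <= n contribute to the coefficient of t^n. *)
Definition psinv1m (f : pser) : pser :=
  fun n => \sum_(k < n.+1) pspow f k n.

End FreeField.

(* Main.v *)
Require Import Defs.
From HB Require Import structures.
From mathcomp Require Import all_boot all_order all_algebra.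
From mathcomp Require Import complex.
From mathcomp Require Import Rstruct.
Set Implicit Arguments. Unset Strict Implicit. Unset Printing Implicit Defensive.
Import Order.TTheory GRing.Theory Num.Theory.
Local Open Scope ring_scope.

(** Write u_n = R_{2n}, v_n = R_{2n+1}. The relation v_n C u_n = u_n v_n propagates,
    and K_n = u_{n+1} u_n^{-1} + C u_{n-1} u_n^{-1}, rewritten in terms of u_n and v_n,
    does not depend on n; at n = 0 it equals y1 + y3, while C = y3 y1 - y2. Hence
    u_{n+2} = (y1 + y3) u_{n+1} - (y3 y1 - y2) u_n, which is the recursion satisfied
    by the coefficients of the continued fraction.

    These manipulations need every R_n with n >= 0 to be nonzero. Specializing
    x = y = 1 gives C<x,y> -> C, and a matrix over C<x,y> whose specialization is
    invertible is full, hence invertible in D. So the specialization extends to the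
    entries of inverses of such matrices, and by induction each R_n takes a positive
    value. *)

(** * Specialization at [x = y = 1], from the free algebra to rational expressions *)

Section Augmentation.
Variables (D : unitAlgType CC) (x y : D).

(** Words may repeat in the list, so a sum of polynomials is a concatenation and a product is a list
    of all pairs. *)
Definition ncpoly_eval (p : seq (CC * seq bool)) : D :=
  \sum_(m <- p) m.1 *: word x y m.2.

Definition ncpoly_aug (p : seq (CC * seq bool)) : CC := \sum_(m <- p) m.1.

(** A relation, because an element of [D] carries no chosen polynomial expression; freeness makes it
    single-valued in [aug_rel_fun]. *)
Definition aug_rel (a : D) (alpha : CC) : Prop :=
  exists p, a = ncpoly_eval p /\ alpha = ncpoly_aug p.

Lemma in_ncpolyP (a : D) : in_ncpoly x y a <-> exists p, a = ncpoly_eval p.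
Proof.
split=> [[s [c ->]]|[p ->]].
  (* Indexing by positions handles lists [c] and [s] of different lengths: a missing coefficient
     defaults to 0. *)
  exists [seq (c`_i, nth [::] s i) | i <- iota 0 (size s)].
  rewrite /ncpoly_eval big_map.
  by rewrite -[X in iota 0 X]subn0 -/(index_iota 0 (size s)) big_mkord.
exists [seq m.2 | m <- p], [seq m.1 | m <- p].
rewrite /ncpoly_eval (big_nth (0, [::])) big_mkord size_map.
by apply: eq_bigr => i _; rewrite !(nth_map (0, [::])).
Qed.

Lemma big_fibers (V : nmodType) (I J : eqType) (p : seq I) (h : I -> J)
    (F : I -> V) :
  \sum_(i <- p) F i =
  \sum_(j <- undup [seq h i | i <- p]) \sum_(i <- p | h i == j) F i.
Proof.
transitivity (\sum_(i <- p) \sum_(j <- undup [seq h i | i <- p] | h i == j) F i).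
  rewrite big_seq [RHS]big_seq; apply: eq_bigr => i ip.
  under eq_bigl => j do rewrite eq_sym.
  rewrite -big_filter filter_pred1_uniq ?undup_uniq ?big_seq1 //.
  by rewrite mem_undup; apply: map_f.
by rewrite (exchange_big_dep xpredT).
Qed.

Hypothesis free_xy : free_monomials x y.

(** Freeness speaks of distinct words, so the terms are first grouped by word. Each grouped
    coefficient then vanishes, and the specialization is the sum of these coefficients. *)
Lemma ncpoly_aug_eq0 p : ncpoly_eval p = 0 -> ncpoly_aug p = 0.
Proof.
pose s := undup [seq m.2 | m <- p].
pose c := [seq \sum_(m <- p | m.2 == w) m.1 | w <- s].
have sc : size c = size s by rewrite size_map.
have cE i : (i < size s)%N ->
    c`_i = \sum_(m <- p | m.2 == nth [::] s i) m.1.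
  by move=> lti; rewrite (nth_map [::]).
rewrite /ncpoly_eval (big_fibers _ snd) -/s => p0.
rewrite /ncpoly_aug (big_fibers _ snd) -/s (big_nth [::]) big_mkord.
apply: big1 => i _; rewrite -cE //; apply: (free_xy (s := s) (c := c)) => //.
  exact: undup_uniq.
rewrite -[RHS]p0 [RHS](big_nth [::]) big_mkord; apply: eq_bigr => j _.
rewrite cE // scaler_suml; apply: eq_bigr => m /eqP -> //.
Qed.

Lemma aug_rel0 : aug_rel 0 0.
Proof. by exists [::]; rewrite /ncpoly_eval /ncpoly_aug !big_nil. Qed.

Lemma aug_rel_word w : aug_rel (word x y w) 1.
Proof.
by exists [:: (1, w)]; rewrite /ncpoly_eval /ncpoly_aug !big_seq1 scale1r.
Qed.

Lemma aug_relD a b alpha beta :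
  aug_rel a alpha -> aug_rel b beta -> aug_rel (a + b) (alpha + beta).
Proof.
move=> [p [-> ->]] [q [-> ->]]; exists (p ++ q).
by rewrite /ncpoly_eval /ncpoly_aug !big_cat.
Qed.

Lemma aug_relM a b alpha beta :
  aug_rel a alpha -> aug_rel b beta -> aug_rel (a * b) (alpha * beta).
Proof.
move=> [p [-> ->]] [q [-> ->]].
exists [seq (m.1 * n.1, m.2 ++ n.2) | m <- p, n <- q].
rewrite /ncpoly_eval /ncpoly_aug !big_allpairs_dep !big_distrl /=.
split; apply: eq_bigr => m _; rewrite big_distrr //=; apply: eq_bigr => n _.
by rewrite /word big_cat /= -scalerAl -scalerAr scalerA.
Qed.

Lemma aug_relN a alpha : aug_rel a alpha -> aug_rel (- a) (- alpha).
Proof.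
move=> [p [-> ->]]; exists [seq (- m.1, m.2) | m <- p].
rewrite /ncpoly_eval /ncpoly_aug !big_map -!sumrN.
by split=> //; apply: eq_bigr => m _; rewrite scaleNr.
Qed.

Lemma aug_rel1 : aug_rel 1 1.
Proof. by have := aug_rel_word [::]; rewrite /word big_nil. Qed.

Lemma aug_rel_fun a alpha beta : aug_rel a alpha -> aug_rel a beta -> alpha = beta.
Proof.
move=> ha hb; apply/eqP; rewrite -subr_eq0; apply/eqP.
have [p []] := aug_relD ha (aug_relN hb).
by rewrite subrr => p0 ->; apply: ncpoly_aug_eq0.
Qed.

Definition aug_mx m n (M : 'M[D]_(m, n)) (A : 'M[CC]_(m, n)) : Prop :=
  forall i j, aug_rel (M i j) (A i j).

Lemma mx_over_aug m n (M : 'M[D]_(m, n)) :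
  mx_over x y M <-> exists A, aug_mx M A.
Proof.
split=> [ovM|[A hA] i j]; last first.
  by apply/in_ncpolyP; have [p [-> _]] := hA i j; exists p.
(* Finite choice over the positions of the matrix collects the entrywise values into one
   function. *)
have [|f fP] := @fin_all_exists ('I_m * 'I_n)%type (fun=> CC)
    (fun ij => aug_rel (M ij.1 ij.2)).
  move=> [i j] /=; have /in_ncpolyP[p ->] := ovM i j.
  by exists (ncpoly_aug p), p.
by exists (\matrix_(i, j) f (i, j)) => i j; rewrite mxE; apply: (fP (i, j)).
Qed.

Lemma aug_mxM m n r (M : 'M_(m, n)) (N : 'M_(n, r)) A B :
  aug_mx M A -> aug_mx N B -> aug_mx (M *m N) (A *m B).
Proof.
move=> hA hB i j; rewrite !mxE.
apply: (big_ind2 aug_rel); first exact: aug_rel0.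
  by move=> ? ? ? ?; apply: aug_relD.
by move=> k _; apply: aug_relM.
Qed.

Lemma aug_mxN m n (M : 'M_(m, n)) A :
  aug_mx M A -> aug_mx (- M) (- A).
Proof. by move=> hA i j; rewrite !mxE; apply: aug_relN. Qed.

Lemma aug_mx0 m n : aug_mx (0 : 'M_(m, n)) 0.
Proof. by move=> i j; rewrite !mxE; apply: aug_rel0. Qed.

Lemma aug_mx_scalar a alpha :
  aug_rel a alpha -> aug_mx (a%:M : 'M_1) alpha%:M.
Proof. by move=> h i j; rewrite !mxE !ord1 !eqxx. Qed.

Lemma aug_row_mx m n1 n2 (M : 'M_(m, n1)) (N : 'M_(m, n2)) A B :
  aug_mx M A -> aug_mx N B -> aug_mx (row_mx M N) (row_mx A B).
Proof. by move=> hA hB i j; rewrite !mxE; case: split => k. Qed.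

Lemma aug_col_mx m1 m2 n (M : 'M_(m1, n)) (N : 'M_(m2, n)) A B :
  aug_mx M A -> aug_mx N B -> aug_mx (col_mx M N) (col_mx A B).
Proof. by move=> hA hB i j; rewrite !mxE; case: split => k. Qed.

Lemma aug_block_mx m1 m2 n1 n2 (M11 : 'M_(m1, n1)) (M12 : 'M_(m1, n2))
    (M21 : 'M_(m2, n1)) (M22 : 'M_(m2, n2)) A11 A12 A21 A22 :
  aug_mx M11 A11 -> aug_mx M12 A12 ->
  aug_mx M21 A21 -> aug_mx M22 A22 ->
  aug_mx (block_mx M11 M12 M21 M22) (block_mx A11 A12 A21 A22).
Proof.
by move=> h11 h12 h21 h22; apply: aug_col_mx; apply: aug_row_mx.
Qed.

(** A factorization of [M] through size [r < n] would specialize to one of [A], forcing the rank of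
    [A] below [n]. *)
Lemma aug_unitmx_full n (M : 'M_n) A :
  aug_mx M A -> A \in unitmx -> full_over x y M.
Proof.
move=> hA uA [r [P [Q [ltrn [/mx_over_aug[B hB] [/mx_over_aug[E hE] defM]]]]]].
have defA : A = B *m E.
  apply/matrixP => i j; apply: aug_rel_fun (hA i j) _.
  by rewrite defM; apply: aug_mxM.
have := leq_ltn_trans (leq_trans (mxrankM_maxl B E) (rank_leq_col B)) ltrn.
by rewrite -defA mxrank_unit // ltnn.
Qed.

Hypothesis full_inv : forall n (M : 'M[D]_n),
  mx_over x y M -> full_over x y M -> mx_invertible M.

Lemma aug_unitmx_invertible n (M : 'M_n) A :
  aug_mx M A -> A \in unitmx -> mx_invertible M.
Proof.
move=> hA uA; apply: full_inv; last exact: aug_unitmx_full hA uA.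
by apply/mx_over_aug; exists A.
Qed.

(* [a = c M^-1 b] takes the value [alpha] at [x = y = 1]; the inverses are encoded
   by solutions [w], [omega] of linear systems, so that no inverse of a matrix over
   the noncommutative ring [D] is needed. *)
Definition rational_value (a : D) (alpha : CC) : Prop :=
  exists n (M : 'M[D]_n) (b w : 'cV[D]_n) (c : 'rV[D]_n)
           (A : 'M[CC]_n) (beta omega : 'cV[CC]_n) (gamma : 'rV[CC]_n),
    [/\ [/\ aug_mx M A, aug_mx b beta & aug_mx c gamma],
        A \in unitmx,
        M *m w = b /\ A *m omega = beta
      & a%:M = c *m w /\ alpha%:M = gamma *m omega].

Lemma rational_value_poly a alpha : aug_rel a alpha -> rational_value a alpha.
Proof.
move=> h; exists 1%N, 1%:M, a%:M, a%:M, 1%:M, 1%:M, alpha%:M, alpha%:M, 1%:M.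
have h1 := aug_mx_scalar aug_rel1.
by rewrite !mul1mx unitmx1; split=> //; split=> //; apply: aug_mx_scalar.
Qed.

Lemma rational_valueD a b alpha beta :
  rational_value a alpha -> rational_value b beta ->
  rational_value (a + b) (alpha + beta).
Proof.
move=> [n [M [v [w [c [A [v' [w' [c' [[hM hv hc] uA [Mw Aw] [cw cw']]]]]]]]]]].
move=> [m [N [f [g [d [B [f' [g' [d' [[hN hf hd] uB [Ng Bg] [dg dg']]]]]]]]]]].
exists (n + m)%N, (block_mx M 0 0 N), (col_mx v f), (col_mx w g), (row_mx c d).
exists (block_mx A 0 0 B), (col_mx v' f'), (col_mx w' g'), (row_mx c' d').
split.
- split; first by apply: aug_block_mx => //; apply: aug_mx0.
    exact: aug_col_mx.
  exact: aug_row_mx.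
- by rewrite unitmxE det_ublock unitrM -!unitmxE uA.
- by rewrite !mul_block_col !mul0mx !addr0 !add0r Mw Aw Ng Bg.
- by rewrite !mul_row_col -cw -cw' -dg -dg' !raddfD.
Qed.

(** The two systems are chained: the second block solves for [g], and [d *m g] (that is, [b]) scales
    the right-hand side [v] of the first, whose solution becomes [w *m b%:M]. *)
Lemma rational_valueM a b alpha beta :
  rational_value a alpha -> rational_value b beta ->
  rational_value (a * b) (alpha * beta).
Proof.
move=> [n [M [v [w [c [A [v' [w' [c' [[hM hv hc] uA [Mw Aw] [cw cw']]]]]]]]]]].
move=> [m [N [f [g [d [B [f' [g' [d' [[hN hf hd] uB [Ng Bg] [dg dg']]]]]]]]]]].
exists (n + m)%N, (block_mx M (- (v *m d)) 0 N), (col_mx 0 f).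
exists (col_mx (w *m b%:M) g), (row_mx c 0).
exists (block_mx A (- (v' *m d')) 0 B), (col_mx 0 f').
exists (col_mx (w' *m beta%:M) g'), (row_mx c' 0).
split.
- split.
  + apply: aug_block_mx => //; last exact: aug_mx0.
    by apply: aug_mxN; apply: aug_mxM.
  + by apply: aug_col_mx => //; apply: aug_mx0.
  + by apply: aug_row_mx => //; apply: aug_mx0.
- by rewrite unitmxE det_ublock unitrM -!unitmxE uA.
- rewrite !mul_block_col !mul0mx !add0r !mulNmx Ng Bg !mulmxA Mw Aw.
  by rewrite -!mulmxA -dg -dg' !subrr.
- rewrite !mul_row_col !mul0mx !addr0 !mulmxA -cw -cw'.
  by rewrite -!scalar_mxM.
Qed.

(** The Schur complement of [A] in the bordered matrix is [- gamma *m omega], that is [- alpha]. *)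
Lemma schur_unitmx n (A : 'M[CC]_n) beta omega gamma (alpha : CC) :
  A \in unitmx -> A *m omega = beta -> alpha%:M = gamma *m omega ->
  alpha != 0 -> block_mx A beta gamma (0 : 'M_1) \in unitmx.
Proof.
move=> uA Aw cw a0.
have -> : block_mx A beta gamma 0 =
    block_mx A 0 gamma 1%:M *m block_mx 1%:M omega 0 (- alpha%:M).
  rewrite mulmx_block !mulmx1 !mulmx0 !mul0mx !addr0 Aw mul1mx.
  by rewrite cw subrr.
rewrite unitmx_mul !unitmxE det_lblock det_ublock !unitrM -!unitmxE uA.
by rewrite !unitmx1 /= unitmxE -scalemx1 -scaleN1r scalerA detZ det1 mulr1
  expr1 unitfE mulN1r oppr_eq0.
Qed.

(* If [a = 0] then [(w, -1)] is a nonzero kernel vector of the bordered matrix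
   [[M, b], [c, 0]], whose specialization is invertible when [alpha != 0]. *)
Lemma rational_value_neq0 a alpha :
  rational_value a alpha -> alpha != 0 -> a != 0.
Proof.
move=> [n [M [v [w [c [A [v' [w' [c' [[hM hv hc] uA [Mw Aw] [cw cw']]]]]]]]]]].
move=> nz; apply/eqP => a0.
have uS := schur_unitmx uA Aw cw' nz.
have [|N [_ NM]] := aug_unitmx_invertible (M := block_mx M v c (0 : 'M_1)) _ uS.
  by apply: aug_block_mx => //; apply: aug_mx0.
have /(congr1 (mulmx N)) :
    block_mx M v c (0 : 'M_1) *m col_mx w (- 1%:M) = 0.
  rewrite mul_block_col Mw mulmxN mulmx1 subrr mul0mx addr0 -cw a0.
  by rewrite raddf0 col_mx0.
rewrite mulmxA NM mul1mx mulmx0 => /(congr1 dsubmx).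
rewrite col_mxKd => /matrixP/(_ 0 0) /eqP.
by rewrite linear0 !mxE eqxx oppr_eq0 oner_eq0.
Qed.

Hypothesis division : forall a : D, a != 0 -> a \is a GRing.unit.

(** The bordered system with right-hand side [(0, 1)] has solution [(w a^-1, - a^-1)]; the row
    [(0, -1)] reads off [a^-1]. *)
Lemma rational_valueV a alpha :
  rational_value a alpha -> alpha != 0 -> rational_value a^-1 alpha^-1.
Proof.
move=> va nz.
have ua := division (rational_value_neq0 va nz).
case: va => [n [M [v [w [c [A [v' [w' [c']]]]]]]]].
move=> [[hM hv hc] uA [Mw Aw] [cw cw']].
exists (n + 1)%N, (block_mx M v c 0), (col_mx 0 1%:M).
exists (col_mx (w *m a^-1%:M) (- a^-1%:M)), (row_mx 0 (- 1%:M)).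
exists (block_mx A v' c' 0), (col_mx 0 1%:M).
exists (col_mx (w' *m alpha^-1%:M) (- alpha^-1%:M)), (row_mx 0 (- 1%:M)).
have h1 := aug_mx_scalar aug_rel1.
split.
- split; first by apply: aug_block_mx => //; apply: aug_mx0.
    by apply: aug_col_mx => //; apply: aug_mx0.
  by apply: aug_row_mx; [apply: aug_mx0 | apply: aug_mxN].
- exact: schur_unitmx Aw cw' nz.
- rewrite !mul_block_col !mul0mx !addr0 !mulmxN !mulmxA Mw Aw -cw -cw' !subrr.
  by rewrite -!scalar_mxM divrr // divff.
- by rewrite !mul_row_col !mul0mx !add0r !mulmxN !mulNmx !opprK !mul1mx.
Qed.

End Augmentation.

(** * Geometric series and the linear recurrence of the continued fraction *)

Section PowerSeries.
Variable D : unitAlgType CC.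
Implicit Types f g : pser D.

Lemma psmul_shift f g n :
  f 0%N = 0 -> psmul f g n.+1 = \sum_(i < n.+1) f i.+1 * g (n - i)%N.
Proof. by move=> f0; rewrite /psmul big_ord_recl f0 mul0r add0r. Qed.

Lemma psmul0 f g : f 0%N = 0 -> psmul f g 0 = 0.
Proof. by move=> f0; rewrite /psmul big_ord1 f0 mul0r. Qed.

Lemma pspow_gt f k n : f 0%N = 0 -> (n < k)%N -> pspow f k n = 0.
Proof.
move=> f0; elim: k n => // k IHk [|n] ltnk /=; first exact: psmul0.
rewrite psmul_shift //; apply: big1 => i _; rewrite IHk ?mulr0 //.
exact: leq_ltn_trans (leq_subr i n) ltnk.
Qed.

(** Powers beyond the [n]-th do not reach degree [n], so the truncation bound, which varies with the
    degree in [psinv1m], can be made uniform. *)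
Lemma psinv1m_widen f n m :
  f 0%N = 0 -> (n <= m)%N -> \sum_(k < m.+1) pspow f k n = psinv1m f n.
Proof.
move=> f0 lenm; rewrite /psinv1m [RHS](big_ord_widen m.+1 (fun k => pspow f k n)) //.
rewrite [RHS]big_mkcond; apply: eq_bigr => k _; case: ltnP => // ltnk.
exact: pspow_gt.
Qed.

Lemma psinv1m0 f : psinv1m f 0 = 1.
Proof. by rewrite /psinv1m big_ord1. Qed.

(** This is [g = 1 + f g] for [g = (1 - f)^-1], read in degree [n.+1]. *)
Lemma psinv1mS f n :
  f 0%N = 0 ->
  psinv1m f n.+1 = \sum_(i < n.+1) f i.+1 * psinv1m f (n - i)%N.
Proof.
move=> f0; rewrite {1}/psinv1m big_ord_recl /= add0r.
under eq_bigr => k _ do rewrite psmul_shift //.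
rewrite exchange_big; apply: eq_bigr => i _; rewrite -mulr_sumr.
by rewrite psinv1m_widen // leq_subr.
Qed.

Lemma psmulCr f a n : psmul f (psC a) n = f n * a.
Proof.
rewrite /psmul big_ord_recr /= subnn big1 ?add0r // => i _.
by rewrite /psC subn_eq0 leqNgt ltn_ord mulr0.
Qed.

Lemma psmul_t f n : psmul (pst D) f n.+1 = f n.
Proof.
rewrite psmul_shift // big_ord_recl big1 => [|i _]; last by rewrite mul0r.
by rewrite mul1r addr0 subn0.
Qed.

Lemma psmul_tt f n : psmul (psmul (pst D) (pst D)) f n.+2 = f n.
Proof.
have t0 : psmul (pst D) (pst D) 0%N = 0 by apply: psmul0.
rewrite psmul_shift // !big_ord_recl !psmul_t big1 => [|i _].
  by rewrite mul0r mul1r add0r addr0 subn1.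
by rewrite psmul_t mul0r.
Qed.

Lemma psinv1m_geometric (a : D) n :
  psinv1m (psmul (pst D) (psC a)) n = a ^+ n.
Proof.
elim: n => [|n IHn]; first by rewrite psinv1m0.
rewrite psinv1mS ?psmul0 // big_ord_recl big1 => [|i _].
  by rewrite psmul_t subn0 IHn addr0 -exprS.
by rewrite psmul_t /psC /= mul0r.
Qed.

Variables (y1 y2 y3 : D).
Let f : pser D :=
  psadd (psmul (pst D) (psC y1))
    (psmul (psmul (pst D) (pst D))
       (psmul (psinv1m (psmul (pst D) (psC y3))) (psC y2))).

Lemma psfrac_coef0 : f 0%N = 0.
Proof. by rewrite /f /psadd !psmul0 ?addr0. Qed.

Lemma psfrac_coef1 : f 1%N = y1.
Proof.
rewrite /f /psadd psmul_t psmul_shift ?psmul0 // big_ord1 psmul_t.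
by rewrite mul0r addr0.
Qed.

Lemma psfrac_coefSS n : f n.+2 = y3 ^+ n * y2.
Proof.
by rewrite /f /psadd psmul_t psmul_tt psmulCr psinv1m_geometric add0r.
Qed.

Lemma psinv1m_frac1 : psinv1m f 1 = y1.
Proof.
by rewrite psinv1mS ?psfrac_coef0 // big_ord1 psfrac_coef1 psinv1m0 mulr1.
Qed.

(** The inner inverse is removed by multiplying by [1 - t y3] on the left: the contribution of
    [t^2 (1 - t y3)^-1 y2] in one degree is [y3] times the previous one plus a single new term. *)
Lemma psinv1m_frac_rec n :
  psinv1m f n.+2 = (y1 + y3) * psinv1m f n.+1 - (y3 * y1 - y2) * psinv1m f n.
Proof.
have tail m : psinv1m f m.+1 - y1 * psinv1m f m =
    \sum_(i < m) y3 ^+ i * y2 * psinv1m f (m - i.+1)%N.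
  rewrite psinv1mS ?psfrac_coef0 // big_ord_recl psfrac_coef1 subn0 addrC addKr.
  by apply: eq_bigr => i _; rewrite psfrac_coefSS.
have : psinv1m f n.+2 - y1 * psinv1m f n.+1 =
    y2 * psinv1m f n + y3 * (psinv1m f n.+1 - y1 * psinv1m f n).
  rewrite !tail big_ord_recl expr0 mul1r subn1; congr (_ + _).
  rewrite mulr_sumr; by apply: eq_bigr => i _; rewrite exprS !mulrA.
move/eqP; rewrite subr_eq => /eqP ->.
rewrite mulrDl mulrBl mulrBr !mulrA opprB.
by rewrite [LHS]addrC -!addrA; congr (_ + _); rewrite addrCA.
Qed.

End PowerSeries.

(** * Quasi-commutation and the conserved quantity of the recurrence *)

Section Conserved.
Variable D : unitRingType.
Implicit Types a b v C : D.

(** Indeed [b C v C a = b C a v = p v = v p = v b C a], and [C a] cancels on the right. It is used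
    with [p = 1 + v] and then with [p = 1 + b ^+ 4]. *)
Lemma quasi_commute_step a b v C (p : D) :
  a \is a GRing.unit -> C \is a GRing.unit ->
  GRing.comm v p -> v * C * a = a * v -> b * C * a = p -> b * C * v = v * b.
Proof.
move=> ua uC vp va ba; apply: (mulIr uC); apply: (mulIr ua).
by rewrite -2!mulrA [v * _]mulrA va mulrA ba -vp -ba !mulrA.
Qed.

(* The term [C u_{n-1} u_n^-1] of [K_n] is expanded through [v_n = R_{2n+1}], so that
   only indices [>= 2n] occur. *)
Definition conserved C a v b : D :=
  b * a^-1 + ((1 + v) * (C * a)^-1 ^+ 2 + (C * a) ^+ 2) * v^-1.

(** * One step, with [a, v, b, v', b'] standing for [u_n, v_n, u_{n+1}, v_{n+1}, u_{n+2}] *)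

Section Step.
Variables (C a v b v' b' : D).
Hypotheses (uC : C \is a GRing.unit) (ua : a \is a GRing.unit)
  (uv : v \is a GRing.unit) (ub : b \is a GRing.unit)
  (uv' : v' \is a GRing.unit).
Hypotheses (va : v * C * a = a * v) (ba : b * C * a = 1 + v)
  (v'v : v' * C * v = 1 + b ^+ 4) (b'b : b' * C * b = 1 + v').

Lemma step_comm_bv : b * C * v = v * b.
Proof.
apply: quasi_commute_step va ba => //.
by rewrite /GRing.comm mulrDl mulrDr mul1r mulr1.
Qed.

Lemma step_comm_v'b : v' * C * b = b * v'.
Proof.
apply: quasi_commute_step step_comm_bv v'v => //.
by rewrite /GRing.comm mulrDl mulrDr mul1r mulr1 -exprS -exprSr.
Qed.

(** Moving [v'^-1] to the left turns powers of [Z] into powers of [b]. What remains besides [b'] is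
    [b^-1 + v'^-1 (1 + b^4) b^-1 = b^-1 + C v b^-1 = b^-1 (1 + v) = C a]. *)
Lemma conserved_prev : conserved C b v' b' * b = b' + C * a.
Proof.
pose Z := C * b.
have uZ : Z \is a GRing.unit by rewrite unitrMl.
have v'Z : v' * Z = b * v' by rewrite mulrA step_comm_v'b.
have ZV : Z * v'^-1 = v'^-1 * b.
  by apply: (mulrI uv'); rewrite mulVKr // mulrA v'Z mulrK.
have Zn k : Z ^+ k * v'^-1 = v'^-1 * b ^+ k.
  by elim: k => [|k IHk]; rewrite ?mulr1 ?mul1r // exprSr -mulrA ZV mulrA IHk
    -mulrA -exprSr.
have ZVV : Z^-1 * v'^-1 = v'^-1 * b^-1.
  by rewrite -!invrM // v'Z.
have Ca : C * a = b^-1 * (1 + v) by rewrite -ba !mulrA mulVr // mul1r.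
have bv : b^-1 * v = C * v * b^-1.
  by apply: (mulIr ub); rewrite mulrVK // -mulrA -step_comm_bv !mulrA mulVr // mul1r.
rewrite /conserved -/Z mulrDl mulrVK // -[_ * v'^-1 * b]mulrA -ZV mulrA.
rewrite [_ * Z]mulrDl expr2 mulrA mulrVK // -exprSr mulrDl Zn.
rewrite mulrDl mul1r [(_ + _) * v'^-1]mulrDl ZVV -[v' * _ * _]mulrA ZVV mulVKr //.
rewrite Ca mulrDr mulr1 bv; congr (_ + _).
rewrite [_ + b^-1]addrC -addrA; congr (_ + _).
have -> : C * v = v'^-1 * (1 + b ^+ 4) by rewrite -v'v !mulrA mulVr // mul1r.
by rewrite mulrDr mulr1 [RHS]mulrDl (exprSr b 3) mulrA mulrK.
Qed.

(** The same right-hand side as in [conserved_prev], now for the quantity one index lower: this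
    equality makes the quantity invariant. Here [b'] is expanded through [v'] until only [a], [b],
    [v] and [C] remain. *)
Lemma conserved_next : conserved C a v b * b = b' + C * a.
Proof.
pose X := C * a.
have uX : X \is a GRing.unit by rewrite unitrMl.
have bX : b * X = 1 + v by rewrite mulrA.
have Vvb : v^-1 * b = b * v^-1 * C^-1.
  apply: (mulIr uC); apply: (mulIr uv); rewrite mulrVK // mulrVK //.
  by rewrite -!mulrA (mulrA b) step_comm_bv mulKr.
have aE : a^-1 = v * X^-1 * v^-1.
  by rewrite -mulrA -invrM // mulrA va invrM // mulVKr.
have -> : b' = b^-1 * C^-1 + b^-1 * v^-1 * C^-1 + b ^+ 2 * v^-1 * b.
  apply: (mulIr uC); apply: (mulIr ub); rewrite b'b.
  have -> : v' = (1 + b ^+ 4) * v^-1 * C^-1 by rewrite -v'v mulrK // mulrK.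
  rewrite !mulrDl !mul1r mulrVK // mulVr // mulrVK // -(mulrA b^-1) Vvb.
  rewrite -!(mulrA b) mulKr // -addrA; congr (_ + (_ + _)).
  by rewrite Vvb mulrVK // -(mulrA b) Vvb !mulrA.
have XCa : C * a = X by [].
clearbody X.
have bXV : (1 + v) * X^-1 ^+ 2 = b * X^-1 by rewrite -bX expr2 mulrA mulrK.
have XE : X = b^-1 * (1 + v) by rewrite -bX mulKr.
have XX : X ^+ 2 * v^-1 * b = X + (b^-1 * v^-1 * C^-1 + b^-1 * C^-1).
  have XVb : X * (v^-1 * b) = v^-1 * C^-1 + 1.
    by rewrite {1}XE -mulrA mulrDl mul1r mulVKr // Vvb mulrDr mulVr // -!mulrA mulKr.
  rewrite expr2 -!mulrA XVb mulrDr mulr1 addrC; congr (_ + _).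
  by rewrite {1}XE -mulrA mulrDl mul1r mulVKr // mulrDr mulrA.
(* By [aE], [a^-1 + X^-1 v^-1 = (1 + v) X^-1 v^-1], which is [b v^-1] because [b X = 1 + v]. *)
have -> : b ^+ 2 * v^-1 * b = b * a^-1 * b + b * X^-1 * v^-1 * b.
  rewrite -mulrDl; congr (_ * _).
  rewrite aE -!mulrA -mulrDr; congr (_ * _).
  rewrite -[X^-1 * v^-1 in X in _ + X]mul1r -mulrDl addrC -bX.
  by rewrite -mulrA mulVKr.
rewrite /conserved XCa bXV mulrDl [_ * v^-1]mulrDl mulrDl XX addrA.
rewrite [RHS]addrAC [RHS]addrC; congr (_ + _).
by rewrite [RHS]addrC; congr (_ + _); rewrite addrC.
Qed.

End Step.
End Conserved.

(** * Elements with positive value at [x = y = 1] *)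

(** In [CC], [0 < alpha] forces [alpha] to be real. Positivity, unlike being nonzero, survives the
    sums [1 + v] and [1 + u ^+ 4]. *)
Definition positive_value (D : unitAlgType CC) (x y a : D) : Prop :=
  exists2 alpha : CC, 0 < alpha & rational_value x y a alpha.

Section Positive.
Variables (D : unitAlgType CC) (x y : D).
Hypothesis free_xy : is_free_skew_field x y.

Lemma positive_value_word w : positive_value x y (word x y w).
Proof.
by exists 1; [apply: ltr01 | apply: rational_value_poly; apply: aug_rel_word].
Qed.

Lemma positive_value1 : positive_value x y 1.
Proof. by have := positive_value_word [::]; rewrite /word big_nil. Qed.

Lemma positive_value_x : positive_value x y x.
Proof. by have := positive_value_word [:: false]; rewrite /word big_seq1. Qed.

Lemma positive_value_y : positive_value x y y.
Proof. by have := positive_value_word [:: true]; rewrite /word big_seq1. Qed.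

Lemma positive_valueD a b :
  positive_value x y a -> positive_value x y b -> positive_value x y (a + b).
Proof.
move=> [alpha ha va] [beta hb vb]; exists (alpha + beta); first exact: addr_gt0.
exact: rational_valueD.
Qed.

Lemma positive_valueM a b :
  positive_value x y a -> positive_value x y b -> positive_value x y (a * b).
Proof.
move=> [alpha ha va] [beta hb vb]; exists (alpha * beta); first exact: mulr_gt0.
exact: rational_valueM.
Qed.

Lemma positive_valueX a n : positive_value x y a -> positive_value x y (a ^+ n).
Proof.
move=> ha; elim: n => [|n IHn]; first exact: positive_value1.
by rewrite exprS; apply: positive_valueM.
Qed.

Lemma positive_value_unit a : positive_value x y a -> a \is a GRing.unit.
Proof.
case: free_xy => divD freeD fullD _ [alpha ha va]; apply: divD.
by apply: rational_value_neq0 va _ => //; rewrite gt_eqF.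
Qed.

Lemma positive_valueV a : positive_value x y a -> positive_value x y a^-1.
Proof.
case: free_xy => divD freeD fullD _ [alpha ha va]; exists alpha^-1.
  by rewrite invr_gt0.
by apply: rational_valueV => //; rewrite gt_eqF.
Qed.

End Positive.

(** * Invertibility of the sequence, the invariant at [n = 0], and the comparison of recurrences *)

Theorem theorem4p3 (D : unitAlgType CC) (x y : D) :
  is_free_skew_field x y ->
  forall R : int -> D,
  let C := x * y * x^-1 * y^-1 in
  (forall n : int, R (2 * n) * C * R (2 * n - 2) = 1 + R (2 * n - 1)) ->
  (forall n : int, R (2 * n + 1) * C * R (2 * n - 1) = 1 + R (2 * n) ^+ 4) ->
  R 0 = y * x * y^-1 ->
  R 1 = y ->
  let u := fun n : nat => R (2 * n%:Z) in
  let y1 := (1 + y) * x^-1 * y * x^-1 * y^-1 in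
  let y2 := (x ^+ 2 + (1 + y) * x^-2 * (1 + y)) * y^-1 * x^-1 * y * x^-1 * y^-1 in
  let y3 := (x ^+ 3 + (1 + y) * x^-1) * x^-1 * y^-1 in
  let t := pst D in
  let f := psadd (psmul t (psC y1))
                 (psmul (psmul t t) (psmul (psinv1m (psmul t (psC y3))) (psC y2))) in
  forall n : nat, u n = psmul (psinv1m f) (psC (u 0%N)) n.
Proof.
move=> free_xy R C Rev Rod R0 R1 u y1 y2 y3 t f.
have px := positive_value_x x y; have py := positive_value_y x y.
have ux := positive_value_unit free_xy px.
have uy := positive_value_unit free_xy py.
have pV := positive_valueV free_xy.
have pM := @positive_valueM _ x y.
have p1D a : positive_value x y a -> positive_value x y (1 + a).
  by apply: positive_valueD; apply: positive_value1.
have pC : positive_value x y C by do ![exact: pV | apply: (pM _ _) => //].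
have uC := positive_value_unit free_xy pC.
pose v (n : nat) := R (2 * n%:Z + 1).
have buC n : u n.+1 * C * u n = 1 + v n.
  have := Rev n.+1%:Z; rewrite /u /v.
  have -> : 2 * n.+1%:Z - 2 = 2 * n%:Z by rewrite intS mulrDr mulr1 addrC addKr.
  by have -> : 2 * n.+1%:Z - 1 = 2 * n%:Z + 1
    by rewrite intS mulrDr mulr1 addrAC [RHS]addrC.
have bvC n : v n.+1 * C * v n = 1 + u n.+1 ^+ 4.
  have := Rod n.+1%:Z; rewrite /u /v.
  by have -> : 2 * n.+1%:Z - 1 = 2 * n%:Z + 1
    by rewrite intS mulrDr mulr1 addrAC [RHS]addrC.
have quot a b p : positive_value x y a -> positive_value x y p ->
    b * C * a = p -> positive_value x y b.
  move=> pa pp e; have ua := positive_value_unit free_xy pa.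
  have -> : b = p * a^-1 * C^-1 by rewrite -e !mulrK.
  by do ![exact: pV | apply: (pM _ _) => //].
have u0E : u 0%N = y * x * y^-1 by rewrite /u mulr0.
have v0E : v 0%N = y by rewrite /v mulr0 add0r.
(* The two parities alternate: [v n] yields [u n.+1], which in turn yields [v n.+1]. *)
have puv n : positive_value x y (u n) /\ positive_value x y (v n).
  elim: n => [|n [pu pv]].
    by rewrite u0E v0E; split=> //; do ![exact: pV | apply: (pM _ _) => //].
  have pu' : positive_value x y (u n.+1) by apply: quot pu (p1D _ pv) (buC n).
  split=> //; apply: quot pv (p1D _ _) (bvC n).
  exact: positive_valueX.
have uu n : u n \is a GRing.unit.
  by apply: (positive_value_unit free_xy); case: (puv n).
have uv n : v n \is a GRing.unit.
  by apply: (positive_value_unit free_xy); case: (puv n).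
have Cu0 : C * u 0%N = x by rewrite u0E /C !mulrA mulrVK // mulrVK // mulrK.
have vCu n : v n * C * u n = u n * v n.
  elim: n => [|n IHn].
    by rewrite -mulrA Cu0 v0E u0E mulrVK.
  exact: step_comm_v'b IHn (buC n) (bvC n).
pose K n := conserved C (u n) (v n) (u n.+1).
have Knext n : K n * u n.+1 = u n.+2 + C * u n.
  exact: conserved_next (vCu n) (buC n) (bvC n) (buC n.+1).
(* Both sides times [u n.+1] equal [u n.+2 + C * u n]. *)
have KS n : K n.+1 = K n.
  apply: (mulIr (uu n.+1)); rewrite (Knext n).
  exact: conserved_prev (vCu n) (buC n) (bvC n).
have K0 n : K n = K 0%N by elim: n => // n IHn; rewrite KS.
have u1E : u 1%N = (1 + y) * x^-1.
  by apply: (mulIr ux); rewrite mulrVK // -v0E -buC -mulrA Cu0.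
have y1E : y1 * u 0%N = u 1%N.
  by rewrite u1E /y1 u0E !mulrA mulrVK // mulrVK // mulrK.
have KE : K 0%N = y1 + y3.
  rewrite /K /conserved Cu0 v0E -y1E mulrK //; congr (_ + _).
  rewrite /y3 [in RHS]mulrDl (exprSr x 2) mulrK //; congr (_ * _).
  by rewrite addrC expr2 mulrA.
(* With the common right factor [Z], and [y^-1] commuting with [1 + y], the terms in [x^-2] cancel.
   The difference is [x^2 y^-1 ((1 + y) - 1) Z = x^2 Z = C]. *)
have CE : C = y3 * y1 - y2.
  pose Z := x^-1 * y * x^-1 * y^-1.
  have -> : y1 = (1 + y) * Z by rewrite /y1 /Z !mulrA.
  have y3E : y3 = (x ^+ 2 + (1 + y) * x^-2) * y^-1.
    rewrite /y3 mulrDl (exprSr x 2) mulrK // -[(1 + y) / x / x]mulrA -invrM // -expr2 //.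
  have -> : y2 = (x ^+ 2 * y^-1 + (1 + y) * x^-2 * (y^-1 * (1 + y))) * Z.
    have -> : y^-1 * (1 + y) = (1 + y) * y^-1.
      by rewrite mulrDl mulrDr mulr1 mul1r mulVr // divrr.
    by rewrite /y2 /Z mulrDl !mulrA.
  rewrite y3E mulrA -mulrBl -mulrA [(x ^+ 2 + _) * _]mulrDl opprD addrACA subrr addr0.
  rewrite -mulrBr [y^-1 * _]mulrDr mulr1 mulVr // addrC addKr mulr1.
  by rewrite /Z !mulrA expr2 mulrK.
have G n : u n = psinv1m f n * u 0%N.
  (* The recurrence has order two, so the induction carries two consecutive indices. *)
  have [] // : u n = psinv1m f n * u 0%N /\ u n.+1 = psinv1m f n.+1 * u 0%N.
  elim: n => [|n [IH1 IH2]].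
    by rewrite psinv1m0 mul1r psinv1m_frac1 y1E.
  split=> //; rewrite psinv1m_frac_rec -KE -CE mulrBl -(mulrA (K 0%N)) -(mulrA C) -IH1 -IH2.
  by rewrite -(K0 n) Knext addrK.
by move=> n; rewrite psmulCr.
Qed.
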